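(* If $\underline{w}$ is a local minimizer (global or not) of $g$ and $\overline{w}$ is the local maximizer of $g$ on $\mathbb{R}^n$, then $$\|\overline{w}\|<\|\underline{w}\|.$$
   Context: Let $n\ge 1$ be an integer, $\nu\in\mathbb{R}$, $\psi=(\psi_1,\dots,\psi_n)^T\in\mathbb{R}^n$, and $D=\mathrm{Diag}(\alpha_1,\dots,\alpha_n)$ a real diagonal matrix with $\alpha_1\le\alpha_2\le\dots\le\alpha_n$. The double well potential function is $g:\mathbb{R}^n\to\mathbb{R}$, $$g(w)=\frac12\left(\frac12\|w\|^2-\nu\right)^2+\frac12 w^TDw-\psi^Tw,$$ where $\|\cdot\|$ is the Euclidean norm. (The function $g$ has at most one local maximizer.) *)

(* Defs.v *)
From HB Require Import structures.
From mathcomp Require Import all_boot all_order all_algebra.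
From mathcomp Require Import all_classical all_reals all_analysis.

Set Implicit Arguments.
Unset Strict Implicit.
Unset Printing Implicit Defensive.

Import Order.TTheory GRing.Theory Num.Theory.
Import numFieldNormedType.Exports.

Local Open Scope classical_set_scope.
Local Open Scope ring_scope.

(* The norm [`|w|] of the library is the sup norm on matrices, hence this
   definition. *)
Definition enorm (R : realType) (n : nat) (w : 'cV[R]_n) : R :=
  Num.sqrt (\sum_(i < n) w i 0 ^+ 2).

(* The products of matrices below are 1 x 1; [0 0] extracts their entry. *)
Definition double_well (R : realType) (n : nat) (nu : R) (psi : 'cV[R]_n)
    (alpha : 'rV[R]_n) (w : 'cV[R]_n) : R :=
  2^-1 * (2^-1 * enorm w ^+ 2 - nu) ^+ 2
  + 2^-1 * (w^T *m diag_mx alpha *m w) 0 0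
  - (psi^T *m w) 0 0.

(* Local extrema are not required to be strict. The neighborhoods are those of
   the topology of the sup norm, which on 'cV[R]_n is the usual one. *)
Definition local_minimizer (R : realType) (n : nat) (f : 'cV[R]_n -> R)
    (w : 'cV[R]_n) : Prop :=
  \forall x \near w, f w <= f x.

Definition local_maximizer (R : realType) (n : nat) (f : 'cV[R]_n -> R)
    (w : 'cV[R]_n) : Prop :=
  \forall x \near w, f x <= f w.

(* Main.v *)
Require Import Defs.
From mathcomp Require Import all_boot all_order all_algebra.
From mathcomp Require Import all_classical all_reals all_analysis.
From mathcomp Require Import ring lra.

Import Order.TTheory GRing.Theory Num.Theory.
Import numFieldNormedType.Exports.

Local Open Scope ring_scope.

(** Write [t w = |w|^2 / 2 - nu].  The second symmetric difference of [g] at [w]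
    along the [i]-th axis is [s^2 (t w + alpha_i + w_i^2 + s^2 / 4)].  Its sign for
    small [s <> 0] gives [t w + alpha_i + w_i^2 >= 0] at a local minimizer, and
    the strict [t w + alpha_i + w_i^2 < 0] at a local maximizer, because the
    quartic term is positive.  If [|wmin| <= |wmax|], then [t wmin <= t wmax], so
    [wmin_i^2 > wmax_i^2] for every [i]; summing over [i] is a contradiction. *)

Lemma enorm_sqr {R : realType} {n : nat} (w : 'cV[R]_n) :
  enorm w ^+ 2 = \sum_(i < n) w i 0 ^+ 2.
Proof. by rewrite sqr_sqrtr // sumr_ge0 // => i _; exact: sqr_ge0. Qed.

Lemma double_wellE {R : realType} {n : nat} (nu : R) (psi : 'cV[R]_n)
    (alpha : 'rV[R]_n) (w : 'cV[R]_n) :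
  double_well nu psi alpha w =
  2^-1 * (2^-1 * (\sum_(i < n) w i 0 ^+ 2) - nu) ^+ 2
  + 2^-1 * (\sum_(i < n) alpha 0 i * w i 0 ^+ 2) - \sum_(i < n) psi i 0 * w i 0.
Proof.
rewrite /double_well enorm_sqr; congr (_ + 2^-1 * _ - _); rewrite !mxE.
  by apply: eq_bigr => i _; rewrite mul_mx_diag !mxE; ring.
by apply: eq_bigr => i _; rewrite mxE.
Qed.

(** A move along the [i]-th axis affects one summand only; this serves the three separable sums of
    [double_wellE]. *)
Lemma sum_axis {R : pzRingType} {n : nat} (F : 'I_n -> R -> R) (w : 'cV[R]_n)
    (i : 'I_n) (s : R) :
  \sum_(j < n) F j ((w + s *: delta_mx i 0) j 0) =
  \sum_(j < n) F j (w j 0) + (F i (w i 0 + s) - F i (w i 0)).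
Proof.
rewrite (bigD1 i) //= [in RHS](bigD1 i) //= !mxE !eqxx mulr1.
rewrite [RHS]addrC addrA subrK; congr (_ + _).
by apply: eq_bigr => j /negPf ji; rewrite !mxE ji mulr0 addr0.
Qed.

(** Adding the values at [s] and [- s] cancels the odd powers of [s], hence the whole contribution
    of [psi]. *)
Lemma double_well_second_difference {R : realType} {n : nat} (nu : R)
    (psi : 'cV[R]_n) (alpha : 'rV[R]_n) (w : 'cV[R]_n) (i : 'I_n) (s : R) :
  double_well nu psi alpha (w + s *: delta_mx i 0)
  + double_well nu psi alpha (w + - s *: delta_mx i 0)
  - 2 * double_well nu psi alpha w =
  s ^+ 2 * (2^-1 * enorm w ^+ 2 - nu + alpha 0 i + w i 0 ^+ 2 + s ^+ 2 / 4).
Proof.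
rewrite !double_wellE enorm_sqr.
rewrite !(sum_axis (fun _ x => x ^+ 2)) !(sum_axis (fun j x => alpha 0 j * x ^+ 2)).
by rewrite !(sum_axis (fun j x => psi j 0 * x)); field.
Qed.

Lemma near_axis {R : realType} {n : nat} {P : 'cV[R]_n -> Prop} {w : 'cV[R]_n}
    (i : 'I_n) :
  (\forall x \near w, P x) ->
  exists2 e : R, 0 < e & forall s, `|s| < e -> P (w + s *: delta_mx i 0).
Proof.
move=> /nbhs_ballP[e /= e0 we]; exists e => // s se; apply: we.
split=> // j k; rewrite /ball /= !mxE opprD addNKr normrN normrM.
(* The entries of [delta_mx i 0] are 0 or 1, so each coordinate moves by at most [|s|]. *)
by apply: le_lt_trans se; rewrite ler_piMr //; case: (_ && _); rewrite ?normr0 ?normr1.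
Qed.

Lemma local_minimizer_axis {R : realType} {n : nat} {nu : R} {psi : 'cV[R]_n}
    {alpha : 'rV[R]_n} {w : 'cV[R]_n} (i : 'I_n) :
  local_minimizer (double_well nu psi alpha) w ->
  0 <= 2^-1 * enorm w ^+ 2 - nu + alpha 0 i + w i 0 ^+ 2.
Proof.
move=> /(near_axis i)[e e0 we]; rewrite leNgt; apply/negP => b0.
have := double_well_second_difference nu psi alpha w i.
set b := (_ + w i 0 ^+ 2) in b0 *.
(* The bound [e / 2] keeps both points in the neighborhood; [s <= 1] and [s <= - b] give
   [s ^+ 2 <= s <= - b], so [b + s ^+ 2 / 4 <= 3 * b / 4 < 0]. *)
pose s := Num.min (e / 2) (Num.min 1 (- b)).
have s0 : 0 < s by rewrite !lt_min; apply/and3P; split; lra.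
have se : s < e by rewrite gt_min; apply/orP; left; lra.
have /andP[s1 sb] : (s <= 1) && (s <= - b) by rewrite -le_min ge_min lexx orbT.
have wp := we s; have wn := we (- s).
rewrite normrN gtr0_norm // in wp wn; move: (wp se) (wn se) => {}wp {}wn /(_ s).
have: s ^+ 2 * (b + s ^+ 2 / 4) < 0 by rewrite pmulr_rlt0 ?exprn_gt0 //; nra.
lra.
Qed.

Lemma local_maximizer_axis {R : realType} {n : nat} {nu : R} {psi : 'cV[R]_n}
    {alpha : 'rV[R]_n} {w : 'cV[R]_n} (i : 'I_n) :
  local_maximizer (double_well nu psi alpha) w ->
  2^-1 * enorm w ^+ 2 - nu + alpha 0 i + w i 0 ^+ 2 < 0.
Proof.
move=> /(near_axis i)[e e0 we]; rewrite ltNge; apply/negP => b0.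
have := double_well_second_difference nu psi alpha w i.
set b := (_ + w i 0 ^+ 2) in b0 *.
(* As [b >= 0], the second difference is positive for every nonzero step, so any step below [e] will
   do. *)
have s0 : 0 < e / 2 by lra.
have wp := we (e / 2); have wn := we (- (e / 2)).
rewrite normrN gtr0_norm // in wp wn.
have se : e / 2 < e by lra.
move: (wp se) (wn se) => {}wp {}wn /(_ (e / 2)).
have: 0 < (e / 2) ^+ 2 * (b + (e / 2) ^+ 2 / 4).
  by rewrite mulr_gt0 ?exprn_gt0 // ltr_wpDl // divr_gt0 ?exprn_gt0.
lra.
Qed.

Theorem theorem6 (R : realType) (n : nat) (hn : (1 <= n)%N) (nu : R)
    (psi : 'cV[R]_n) (alpha : 'rV[R]_n)
    (halpha : forall i j : 'I_n, (i <= j)%N -> alpha 0 i <= alpha 0 j)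
    (wmin wmax : 'cV[R]_n)
    (hmin : local_minimizer (double_well nu psi alpha) wmin)
    (hmax : local_maximizer (double_well nu psi alpha) wmax) :
  enorm wmax < enorm wmin.
Proof.
rewrite ltNge; apply/negP => le_norm.
have le_sqr : enorm wmin ^+ 2 <= enorm wmax ^+ 2.
  by rewrite ler_pXn2r // nnegrE sqrtr_ge0.
have lt_coord i : wmax i 0 ^+ 2 < wmin i 0 ^+ 2.
  have := local_minimizer_axis i hmin.
  have := local_maximizer_axis i hmax.
  lra.
move: le_sqr; rewrite leNgt !enorm_sqr => /negP; apply.
(* Strictness of the sum requires at least one index, which [hn] provides. *)
apply: ltr_sum => [|i _]; last exact: lt_coord.
by apply/hasP; exists (Ordinal hn); rewrite // mem_index_enum.
Qed.
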